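(* Let $n$ be a positive integer, let $E_n$ be the exterior algebra over $\mathbb{C}$ on $n$ generators, and let $f,g\in E_n$ be two generic quadratic forms. Then for every $s\ge 0$ the dimension over $\mathbb{C}$ of the $s$-th graded component of $E_n/(f,g)$ is at most $a(n,s)$.
   Context: $E_n$ is the exterior algebra over $\mathbb{C}$ on generators $x_1,\ldots,x_n$ of degree one. Forms are called generic if all their coefficients (of both forms, taken together) are mutually algebraically independent over $\mathbb{Q}$. For integers $n,s$ with $s\ge 0$, $a(n,s)$ denotes the number of lattice paths inside the rectangle $(n+2-2s)\times(n+2)$ (width $n+2-2s$, height $n+2$, boundary included) from the bottom left corner $(0,0)$ to the top right corner $(n+2-2s,n+2)$ with moves of two types: $(x,y)\to(x+1,y+1)$ or $(x,y)\to(x-1,y+1)$. If $n+2-2s<0$ then $a(n,s)=0$. *)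

(* Defs.v *)
From HB Require Import structures.
From mathcomp Require Import all_boot all_order all_algebra all_field.
From mathcomp Require Import reals complex.
From mathcomp Require Import mpoly ring.

Set Implicit Arguments.
Unset Strict Implicit.
Unset Printing Implicit Defensive.

Import GRing.Theory.
Local Open Scope ring_scope.

(* The exterior algebra on x_0, ..., x_(n-1) over K, in coordinates: u A is   *)
(* the coefficient of u on the monomial x_A, the product of the x_i, i \in A, *)
(* taken in increasing order of i (see ext_monomE). The copy of the field is  *)
(* K^o so that the K-vector space structure on finite functions applies; the  *)
(* alias [exterior] keeps the pointwise product of {ffun _} out of the way.   *)
Definition exterior (K : fieldType) (n : nat) : Type :=
  {ffun {set 'I_n} -> K^o}.

HB.instance Definition _ (K : fieldType) (n : nat) :=
  Vector.copy (exterior K n) {ffun {set 'I_n} -> K^o}.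

Section ExteriorAlgebra.
Variables (K : fieldType) (n : nat).
Implicit Types (A B C D : {set 'I_n}) (u v w : exterior K n).

Definition ext_coef u A : K := (u : {ffun {set 'I_n} -> K^o}) A.

Definition ext_monom A : exterior K n :=
  ([ffun B : {set 'I_n} => (B == A)%:R : K^o] : {ffun {set 'I_n} -> K^o}).

Definition ext_gen (i : 'I_n) : exterior K n := ext_monom [set i].

(* Number of transpositions needed to sort the concatenation of the           *)
(* increasing enumerations of B and C.                                        *)
Definition inversions B C : nat := (\sum_(i in B) \sum_(j in C) (j < i))%N.

Definition ext_sign B C : K := (-1) ^+ inversions B C.

(* The wedge product: x_B * x_C is +/- x_(B :|: C) if B and C are disjoint,   *)
(* and 0 otherwise (see ext_monomM).                                          *)
Definition ext_mul u v : exterior K n :=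
  ([ffun A : {set 'I_n} => \sum_(B : {set 'I_n} | B \subset A)
     ext_sign B (A :\: B) * ext_coef u B * ext_coef v (A :\: B) : K^o]
   : {ffun {set 'I_n} -> K^o}).

Lemma ext_eqP u v : (forall A, ext_coef u A = ext_coef v A) -> u = v.
Proof. by move=> eq_uv; apply/ffunP. Qed.

Lemma ext_coefD u v A : ext_coef (u + v) A = ext_coef u A + ext_coef v A.
Proof. exact: ffunE. Qed.

Lemma ext_coefN u A : ext_coef (- u) A = - ext_coef u A.
Proof. exact: ffunE. Qed.

Lemma ext_coef0 A : ext_coef 0 A = 0.
Proof. exact: ffunE. Qed.

Lemma ext_coefZ (a : K) u A : ext_coef (a *: u) A = a * ext_coef u A.
Proof. exact: ffunE. Qed.

Lemma ext_coef_monom A B : ext_coef (ext_monom A) B = (B == A)%:R.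
Proof. exact: ffunE. Qed.

Lemma ext_coef_mul u v A : ext_coef (ext_mul u v) A =
  \sum_(B : {set 'I_n} | B \subset A)
     ext_sign B (A :\: B) * ext_coef u B * ext_coef v (A :\: B).
Proof. exact: ffunE. Qed.

Lemma big_disjointU B C (F : 'I_n -> nat) : [disjoint B & C] ->
  (\sum_(i in B :|: C) F i = \sum_(i in B) F i + \sum_(i in C) F i)%N.
Proof.
by move=> dBC; rewrite -bigU //; apply: eq_bigl => i; rewrite !inE.
Qed.

Lemma inversions_setUl B C D : [disjoint B & C] ->
  inversions (B :|: C) D = (inversions B D + inversions C D)%N.
Proof. by move=> dBC; rewrite /inversions big_disjointU. Qed.

Lemma inversions_setUr B C D : [disjoint C & D] ->
  inversions B (C :|: D) = (inversions B C + inversions B D)%N.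
Proof.
move=> dCD; rewrite /inversions -big_split /=; apply: eq_bigr => i _.
by rewrite big_disjointU.
Qed.

Lemma ext_mulA : associative ext_mul.
Proof.
move=> u v w; apply: ext_eqP => A; rewrite !ext_coef_mul.
under eq_bigr do rewrite ext_coef_mul mulr_sumr.
under [RHS]eq_bigr do rewrite ext_coef_mul mulr_sumr mulr_suml.
rewrite [RHS](exchange_big_dep (fun D => D \subset A)) /=; last first.
  by move=> B D sBA sDB; apply: subset_trans sBA.
apply: eq_bigr => D sDA.
rewrite [RHS](reindex_onto (fun C => D :|: C) (fun B => B :\: D)) /=; last first.
  by move=> B /andP[_ sDB]; rewrite setDE setUIr setUCr setIT; apply/setUidPr.
apply: eq_big => [C|C sC].
  rewrite subUset sDA subsetUl andbT /= subsetD; congr (_ && _).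
  rewrite setDUl setDv set0U; by rewrite (sameP setDidPl eqP).
have dCD : [disjoint D & C].
  by move: sC; rewrite subsetD disjoint_sym => /andP[].
have -> : (D :|: C) :\: D = C.
  by rewrite setDUl setDv set0U; apply/setDidPl; rewrite disjoint_sym.
rewrite -setDDl; set T := (A :\: D) :\: C.
have dCT : [disjoint C & T] by rewrite -setI_eq0 setIDA setIC -setIDA setDv setI0.
have eAD : A :\: D = C :|: T.
  by rewrite /T -{1}(setID (A :\: D) C); congr (_ :|: _); apply/setIidPr.
have -> : ext_sign D (A :\: D) = ext_sign D C * ext_sign D T.
  by rewrite /ext_sign eAD inversions_setUr // exprD.
have -> : ext_sign (D :|: C) T = ext_sign D T * ext_sign C T.
  by rewrite /ext_sign inversions_setUl // exprD.
by ring.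
Qed.

Lemma inversions0l A : inversions set0 A = 0%N.
Proof. by rewrite /inversions big_set0. Qed.

Lemma inversions0r A : inversions A set0 = 0%N.
Proof. by rewrite /inversions big1 // => i _; rewrite big_set0. Qed.

Lemma ext_monomM B C : ext_mul (ext_monom B) (ext_monom C) =
  if [disjoint B & C] then ext_sign B C *: ext_monom (B :|: C) else 0.
Proof.
apply: ext_eqP => A; rewrite ext_coef_mul.
under eq_bigr do rewrite !ext_coef_monom.
have [sBA|nsBA] := boolP (B \subset A); last first.
  rewrite big1 => [|D sDA]; last first.
    case: (D =P B) => [eD|_]; last by rewrite mulr0 mul0r.
    by rewrite -eD sDA in nsBA.
  case: ifP => _; rewrite ?ext_coef0 // ext_coefZ ext_coef_monom.
  case: (A =P _) => [eA|_]; last by rewrite mulr0.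
  by rewrite eA subsetUl in nsBA.
rewrite (bigD1 B) //= big1 ?addr0 => [|D /andP[_ /negPf->]]; last first.
  by rewrite mulr0 mul0r.
rewrite eqxx mulr1; case: eqP => [<-|neC].
  have -> : [disjoint B & A :\: B].
    by rewrite -setI_eq0 setDE setIC -setIA [_ :&: B]setIC setICr setI0.
  have -> : B :|: (A :\: B) = A by rewrite -{2}(setID A B) (setIidPr sBA).
  by rewrite ext_coefZ ext_coef_monom eqxx mulr1.
rewrite mulr0; case: ifP => [dBC|_]; last by rewrite ext_coef0.
rewrite ext_coefZ ext_coef_monom; case: eqP => [eA|_]; last by rewrite mulr0.
case: neC; rewrite eA setDUl setDv set0U; apply/setDidPl.
by rewrite disjoint_sym.
Qed.

Lemma ext_mul1l : left_id (ext_monom set0) ext_mul.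
Proof.
move=> u; apply: ext_eqP => A; rewrite ext_coef_mul (bigD1 set0) ?sub0set //=.
rewrite big1 ?addr0 => [|D /andP[_ /negPf nD]]; last first.
  by rewrite ext_coef_monom nD mulr0 mul0r.
by rewrite ext_coef_monom eqxx setD0 /ext_sign inversions0l expr0 !mul1r.
Qed.

Lemma ext_mul1r : right_id (ext_monom set0) ext_mul.
Proof.
move=> u; apply: ext_eqP => A; rewrite ext_coef_mul (bigD1 A) //=.
rewrite big1 ?addr0 => [|D /andP[sDA neDA]]; last first.
  rewrite ext_coef_monom setD_eq0.
  have [sAD|_] := boolP (A \subset D); last by rewrite mulr0.
  by rewrite eqEsubset sDA sAD in neDA.
by rewrite ext_coef_monom setDv eqxx /ext_sign inversions0r expr0 mul1r mulr1.
Qed.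

Lemma ext_mulDl : left_distributive ext_mul +%R.
Proof.
move=> u v w; apply: ext_eqP => A; rewrite ext_coefD !ext_coef_mul -big_split /=.
by apply: eq_bigr => B _; rewrite ext_coefD mulrDr mulrDl.
Qed.

Lemma ext_mulDr : right_distributive ext_mul +%R.
Proof.
move=> u v w; apply: ext_eqP => A; rewrite ext_coefD !ext_coef_mul -big_split /=.
by apply: eq_bigr => B _; rewrite ext_coefD mulrDr.
Qed.

Lemma ext_monom_neq0 A : ext_monom A != 0.
Proof.
apply/eqP => /(congr1 (ext_coef^~ A)) /eqP.
by rewrite ext_coef_monom ext_coef0 eqxx oner_eq0.
Qed.

Lemma ext_scalerAl (a : K) u v : a *: ext_mul u v = ext_mul (a *: u) v.
Proof.
apply: ext_eqP => A; rewrite ext_coefZ !ext_coef_mul mulr_sumr.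
by apply: eq_bigr => B _; rewrite ext_coefZ; ring.
Qed.

Lemma ext_scalerAr (a : K) u v : a *: ext_mul u v = ext_mul u (a *: v).
Proof.
apply: ext_eqP => A; rewrite ext_coefZ !ext_coef_mul mulr_sumr.
by apply: eq_bigr => B _; rewrite ext_coefZ; ring.
Qed.

End ExteriorAlgebra.

HB.instance Definition _ (K : fieldType) (n : nat) :=
  GRing.Zmodule_isNzRing.Build (exterior K n) (@ext_mulA K n) (@ext_mul1l K n)
    (@ext_mul1r K n) (@ext_mulDl K n) (@ext_mulDr K n)
    (@ext_monom_neq0 K n set0).

HB.instance Definition _ (K : fieldType) (n : nat) :=
  GRing.Lmodule_isLalgebra.Build K (exterior K n) (@ext_scalerAl K n).

HB.instance Definition _ (K : fieldType) (n : nat) :=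
  GRing.Lalgebra_isAlgebra.Build K (exterior K n) (@ext_scalerAr K n).

HB.instance Definition _ (K : fieldType) (n : nat) :=
  Algebra_isFalgebra.Build K (exterior K n).

Section ExteriorTheory.
Variables (K : fieldType) (n : nat).
Implicit Types (i j : 'I_n) (A : {set 'I_n}).
Notation E := (exterior K n).
Notation x := (@ext_gen K n).

Lemma ext_gen_sqr i : x i * x i = 0.
Proof. by rewrite [LHS]ext_monomM disjoints1 inE eqxx. Qed.

Lemma ext_gen_anticomm i j : x i * x j = - (x j * x i).
Proof.
have [->|neq_ij] := eqVneq i j; first by rewrite ext_gen_sqr oppr0.
rewrite [x i * x j]ext_monomM [x j * x i]ext_monomM !disjoints1 !inE.
rewrite [j == i]eq_sym (negPf neq_ij) /ext_sign /inversions !big_set1 setUC -scaleNr.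
by case: ltngtP neq_ij => [||/val_inj->] //=; rewrite ?expr0 ?expr1 ?opprK ?eqxx.
Qed.

Lemma ext_monom_sorted (s : seq 'I_n) : sorted (fun i j => i < j)%N s ->
  \prod_(i <- s) x i = ext_monom K [set i in s].
Proof.
elim: s => [|a s IHs] /= s_sorted.
  by rewrite big_nil; congr ext_monom; apply/setP => i; rewrite !inE.
rewrite big_cons IHs ?(path_sorted s_sorted) // [LHS]ext_monomM.
have a_min : {in s, forall j, (a < j)%N}.
  by apply/allP; apply: order_path_min s_sorted => i j k; apply: ltn_trans.
have -> : [disjoint [set a] & [set i in s]].
  by rewrite disjoints1 inE; apply/negP => /a_min; rewrite ltnn.
rewrite /ext_sign /inversions big_set1 big1 => [|j].
  by rewrite expr0 scale1r; congr ext_monom; apply/setP => i; rewrite !inE.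
by rewrite inE => /a_min /ltnW; rewrite ltnNge => ->.
Qed.

Lemma ext_monomE A : ext_monom K A = \prod_(i <- enum A) x i.
Proof.
rewrite ext_monom_sorted.
  by congr ext_monom; apply/setP => i; rewrite inE mem_enum.
rewrite {1}/enum_mem; apply: sorted_filter => [i j k|]; first exact: ltn_trans.
have: sorted (relpre val ltn) (enum 'I_n).
  by rewrite -sorted_map val_enum_ord iota_ltn_sorted.
by rewrite enumT.
Qed.

Lemma ext_coef_sum (I : finType) (F : I -> E) A :
  ext_coef (\sum_k F k) A = \sum_k ext_coef (F k) A.
Proof.
elim/big_rec2: _ => [|k a v _ IHv]; first exact: ext_coef0.
by rewrite ext_coefD -IHv.
Qed.

Lemma ext_monom_sum (u : E) : u = \sum_A ext_coef u A *: ext_monom K A.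
Proof.
apply: ext_eqP => B; rewrite ext_coef_sum (bigD1 B) //= big1 => [|A /negPf neAB].
  by rewrite ext_coefZ ext_coef_monom eqxx mulr1 addr0.
by rewrite ext_coefZ ext_coef_monom eq_sym neAB mulr0.
Qed.

End ExteriorTheory.

Definition ext_graded (K : fieldType) (n s : nat) : {vspace exterior K n} :=
  <<[seq ext_monom K A | A : {set 'I_n} in [set A : {set 'I_n} | #|A| == s]]>>%VS.

Lemma dim_ext_graded (K : fieldType) (n s : nat) :
  \dim (ext_graded K n s) = 'C(n, s).
Proof.
rewrite -[n in RHS]card_ord -card_draws -(size_image (@ext_monom K n)).
apply/eqP; set P := [set _ | _]; set X := image _ _.
suff: free (in_tuple X) by [].
apply/freeP => k sum0 i; pose j := cast_ord (size_image _ _) i.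
have XE (l : 'I_(size X)) :
    X`_l = ext_monom K (enum_val (cast_ord (size_image _ _) l)).
  by rewrite -(nth_image 0 (@ext_monom K n)).
have := congr1 (fun v => ext_coef v (enum_val j)) sum0.
rewrite ext_coef_sum ext_coef0 (bigD1 i) //= big1 => [|l neq_li].
  by rewrite XE ext_coefZ ext_coef_monom eqxx mulr1 addr0.
rewrite XE ext_coefZ ext_coef_monom (inj_eq enum_val_inj).
by rewrite (inj_eq (@cast_ord_inj _ _ _)) eq_sym (negPf neq_li) mulr0.
Qed.

Definition ideal_gen2 (K : fieldType) (aT : falgType K) (f g : aT) :
  {vspace aT} := (fullv * <<[:: f; g]>> * fullv)%VS.

(* The quotient map V -> V / I, the quotient being realized on a complement   *)
(* of I in V: an endomorphism of V with kernel exactly I.                     *)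
Definition quot_map (K : fieldType) (vT : vectType K) (I : {vspace vT}) :
  'End(vT) := (\1 - projv I)%VF.

Lemma lker_quot_map (K : fieldType) (vT : vectType K) (I : {vspace vT}) :
  lker (quot_map I) = I.
Proof.
apply/vspaceP => v; rewrite memv_ker !lfunE /= !lfunE /= subr_eq0.
apply/eqP/idP => [->|vI]; first exact: memv_proj.
by rewrite projv_id.
Qed.

(* The degree s component of E_n / I is the image of that of E_n.             *)
Definition quot_graded (K : fieldType) (n : nat)
    (I : {vspace exterior K n}) (s : nat) : {vspace exterior K n} :=
  (quot_map I @: ext_graded K n s)%VS.

Lemma dim_quot_graded (K : fieldType) (n : nat)
    (I : {vspace exterior K n}) (s : nat) :
  (\dim (ext_graded K n s :&: I) + \dim (quot_graded I s))%N =
    \dim (ext_graded K n s).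
Proof. by rewrite -{1}(lker_quot_map I) limg_ker_dim. Qed.

Definition alg_independent (K : fieldType) (T : finType) (z : T -> K) : Prop :=
  forall p : {mpoly rat[#|T|]},
    (map_mpoly (ratr : rat -> K) p).@[fun k => z (enum_val k)] = 0 -> p = 0.

(* All the coefficients of the quadratic forms f and g, on the monomials      *)
(* x_i x_j with i < j, as a single family.                                    *)
Definition quad_coefs (K : fieldType) (n : nat) (f g : exterior K n)
    (k : bool * {A : {set 'I_n} | #|A| == 2}) : K :=
  ext_coef (if k.1 then f else g) (val k.2).

Definition generic_quadratic_pair (K : fieldType) (n : nat)
    (f g : exterior K n) : Prop :=
  [/\ f \in ext_graded K n 2, g \in ext_graded K n 2
    & alg_independent (quad_coefs f g)].

Section LatticePaths.
Variables w h : nat.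

(* The lattice points (x, y) with 0 <= x <= w and 0 <= y <= h.                *)
Definition rectangle : finType := ('I_w.+1 * 'I_h.+1)%type.

Definition path_move (p q : rectangle) : bool :=
  (q.2 == p.2.+1 :> nat) && ((q.1 == p.1.+1 :> nat) || (p.1 == q.1.+1 :> nat)).

(* A path is given by its points after the initial one; since every move      *)
(* raises y by 1, the paths from y = 0 to y = h have exactly h moves.         *)
Definition lattice_paths : {set h.-tuple rectangle} :=
  [set t : h.-tuple rectangle | path path_move (ord0, ord0) t
                              & last (ord0, ord0) t == (ord_max, ord_max)].

End LatticePaths.

Definition num_paths (n s : nat) : nat :=
  if (2 * s <= n + 2)%N then #|lattice_paths (n + 2 - 2 * s)%N (n + 2)%N| else 0%N.

(* Main.v *)
Require Import Defs.
From mathcomp Require Import all_boot all_order all_algebra all_field.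
From mathcomp Require Import reals complex.
From mathcomp Require Import mpoly zify ring.

(** Read a set A of s indices as a word of n letters, i being a down step if
    i \in A and an up step otherwise. With an up step added at each end, A
    becomes a walk from 0 to n + 2 - 2s in n + 2 steps, and it stays in the
    strip [0, n + 2 - 2s] exactly when, for all j, at most j of the first 2j
    indices and at most j of the last 2j indices lie in A. Call A crowded if
    this fails. As 'C(n, s) counts all A, it suffices that the degree s part of
    the ideal (f, g) has dimension at least the number of crowded A
    ([card_crowded_le_dim]); the other A inject into the lattice paths
    ([card_balanced_le_num_paths]).

    For one form the bound comes from a leading term argument
    ([block_form_leading]). Let y_k be the product of the two generators with
    indices 2k and 2k+1, let h be the sum of the y_k, and let A contain more
    than j of the first 2j indices. Among the pairs k < j, there are d pairs
    contained in A for some d, and fewer than d pairs disjoint from A. Up to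
    sign, d! x_A is (y_D)^d x_A0, where y_D sums the y_k over the full pairs
    and A0 is A without them. Modulo h, y_D is minus the sum of all other y_k:
    those of the half-full pairs kill x_A0, those of the empty pairs have zero
    d-th power since there are fewer than d of them, and so each surviving
    monomial contains a whole pair k >= j. Giving the generator i the weight
    2^i, such monomials are heavier than x_A, so that x_A is the lightest
    monomial of a multiple of h.

    For two forms, take the form h above and the form built in the same way
    from the last indices, and rescale the generators by powers of t according
    to the weights, independently for the two forms. As t tends to 0 the
    multiples found above tend to the monomials x_A themselves, so the two
    families, although they are triangular for opposite orders of the
    variables, become linearly independent together: the determinant of their
    coefficients on the crowded monomials is a polynomial in t with value 1 at
    0 ([exists_independent_multiples]). With the multipliers fixed over the
    rationals, this determinant is a polynomial in the coefficients of f and g.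
    It does not vanish identically, hence not at algebraically independent
    coefficients ([generic_independent_multiples]). *)

Set Implicit Arguments.
Unset Strict Implicit.
Unset Printing Implicit Defensive.

Import GRing.Theory Num.Theory.
Local Open Scope ring_scope.

(** * Products of even monomials *)

(** Expand (z_k + S)^m by the binomial theorem, which stops after the term that
    is linear in z_k: only multilinear monomials in the z_k survive. *)
Lemma pow_sum_sqr0 (R : nzRingType) (I : Type) (z : I -> R) (r : seq I) :
  (forall k l, GRing.comm (z k) (z l)) -> (forall k, z k * z k = 0) ->
  (\sum_(k <- r) z k) ^+ size r = (size r)`!%:R * \prod_(k <- r) z k
  /\ (\sum_(k <- r) z k) ^+ (size r).+1 = 0.
Proof.
move=> z_comm z_sqr; elim: r => [|k r [IHr IHr0]] /=.
  by rewrite !big_nil expr0 expr1 mulr1.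
rewrite !big_cons; set S := \sum_(l <- r) z l in IHr IHr0 *.
have zS : GRing.comm (z k) S by apply: commr_sum.
have expD m : (z k + S) ^+ m.+1 = S ^+ m.+1 + (z k * S ^+ m) *+ m.+1.
  elim: m => [|m IHm]; first by rewrite !expr1 expr0 mulr1 addrC.
  rewrite exprS IHm mulrDr !mulrDl !mulrnAr [z k * (z k * _)]mulrA z_sqr.
  rewrite mul0r mul0rn add0r.
  by rewrite mulrA -zS -mulrA -!exprS addrAC addrC -mulrS.
rewrite !expD IHr0 !(mulr0, mul0rn, add0r, addr0).
split; last by rewrite exprS IHr0 mulr0.
rewrite IHr factS natrM -mulrnAl -mulr_natl !mulrA; congr (_ * _).
by rewrite -!mulrA (commr_nat (z k)).
Qed.

Section Monomials.
Variables (K : fieldType) (n : nat).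
Implicit Types (A B P : {set 'I_n}) (u : exterior K n).

Lemma ext_coef_big (I : Type) (r : seq I) (Q : pred I)
    (F : I -> exterior K n) A :
  ext_coef (\sum_(k <- r | Q k) F k) A = \sum_(k <- r | Q k) ext_coef (F k) A.
Proof.
exact: (big_morph (@ext_coef K n ^~ A) (fun u v => ext_coefD u v A)
                  (ext_coef0 K A)).
Qed.

Lemma inversions_sym P A : [disjoint P & A] ->
  (inversions P A + inversions A P = #|P| * #|A|)%N.
Proof.
move=> dPA; rewrite /inversions [X in (_ + X)%N]exchange_big /= -big_split /=.
rewrite -sum_nat_const; apply: eq_bigr => i iP.
rewrite -big_split /= -sum1_card; apply: eq_bigr => j jA.
have : i != j by apply: contraTneq jA => <-; rewrite (disjointFr dPA).
by rewrite -(inj_eq val_inj) /=; case: ltngtP.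
Qed.

(** The block forms are thus central, which makes powers of their partial sums
    behave as in a commutative ring. *)
Lemma comm_even_monom P u : ~~ odd #|P| -> GRing.comm (ext_monom K P) u.
Proof.
move=> evenP; rewrite (ext_monom_sum u); apply: commr_sum => A _.
rewrite /GRing.comm -scalerAr -scalerAl; congr (_ *: _).
rewrite [LHS]ext_monomM [RHS]ext_monomM disjoint_sym.
case: ifP => // dAP; rewrite setUC /ext_sign; congr (_ *: _).
rewrite -signr_odd -[RHS]signr_odd; congr (_ ^+ nat_of_bool _); apply/eqP.
have := inversions_sym (P := P) (A := A); rewrite disjoint_sym dAP => /(_ isT).
move/(congr1 odd); rewrite oddD oddM (negPf evenP) /= => /negbT.
by case: odd; case: odd.
Qed.

Lemma ext_monom_sqr P : P != set0 -> ext_monom K P * ext_monom K P = 0.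
Proof.
by move=> P0; rewrite [LHS]ext_monomM -setI_eq0 setIid (negPf P0).
Qed.

Lemma ext_coef_mul_monom u A B :
  ~~ (A \subset B) -> ext_coef (u * ext_monom K A) B = 0.
Proof.
move=> nAB; rewrite [LHS]ext_coef_mul big1 // => C sC.
rewrite ext_coef_monom; case: eqP => [eA|_]; last by rewrite mulr0.
by rewrite -eA subsetDl in nAB.
Qed.

Lemma prod_monom_setD (I : eqType) (P : I -> {set 'I_n}) (r : seq I) A :
    uniq r -> (forall k, k \in r -> P k \subset A) ->
    (forall k l, k != l -> [disjoint P k & P l]) ->
  exists b : bool, (\prod_(k <- r) ext_monom K (P k))
    * ext_monom K (A :\: \bigcup_(k <- r) P k) = (-1) ^+ b *: ext_monom K A.
Proof.
elim: r A => [|k r IHr] A /=.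
  by exists false; rewrite !big_nil setD0 mul1r scale1r.
case/andP=> kr r_uniq sPA dP; rewrite !big_cons -setDDl.
have sPk : P k \subset A by apply: sPA; rewrite inE eqxx.
have [|//|b IHb] := IHr (A :\: P k) r_uniq.
  move=> l lr; rewrite subsetD sPA ?inE ?lr ?orbT // dP //.
  by apply: contraNneq kr => <-.
have dk : [disjoint P k & A :\: P k].
  by rewrite disjoint_sym disjoints_subset subsetDr.
exists (b (+) odd (inversions (P k) (A :\: P k))).
rewrite -mulrA IHb -scalerAr [_ * _]ext_monomM dk scalerA.
rewrite signr_addb /ext_sign [in RHS]signr_odd; congr (_ *: ext_monom K _).
by rewrite setDE setUIr setUCr setIT; apply/setUidPr.
Qed.

End Monomials.

(** * Blocks of two indices, weights and initial segments *)

Section Blocks.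
(* sigma i is the position of the index i: the two forms read the indices
   from the two ends. *)
Variables (n : nat) (sigma : 'I_n -> 'I_n).
Hypothesis sigma_inj : injective sigma.
Implicit Types (A B : {set 'I_n}).

Definition block (k : nat) : {set 'I_n} := [set i | (sigma i)./2 == k].

Definition block_form (K : fieldType) : exterior K n :=
  \sum_(k < n./2) ext_monom K (block k).

(** Powers of two make one index heavier than all indices of smaller position
    together. *)
Definition weight A : nat := (\sum_(i in A) 2 ^ sigma i)%N.

Definition initial_count A (c : nat) : nat := #|[set a in A | (sigma a < c)%N]|.

Lemma block_disjoint k l : k != l -> [disjoint block k & block l].
Proof.
move=> neq_kl; rewrite -setI_eq0; apply/eqP/setP => i; rewrite !inE.
by case: eqP => [->|//]; rewrite (negPf neq_kl).
Qed.

Lemma card_block k : (k < n./2)%N -> #|block k| = 2.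
Proof.
move=> lt_k; have lt1 : (k.*2.+1 < n)%N by lia.
have lt0 : (k.*2 < n)%N by lia.
have -> : block k = sigma @^-1: [set Ordinal lt0; Ordinal lt1].
  by apply/setP => i; rewrite !inE -!val_eqE /=; apply/idP/idP; lia.
by rewrite card_preimset // cards2 -val_eqE /= neq_ltn ltnSn.
Qed.

Lemma weight_setU A B : [disjoint A & B] ->
  weight (A :|: B) = (weight A + weight B)%N.
Proof. exact: big_disjointU. Qed.

Lemma weight_sub A B : A \subset B -> (weight A <= weight B)%N.
Proof.
move=> sAB; rewrite -(setID B A) (setIidPr sAB) weight_setU ?leq_addr //.
by rewrite disjoint_sym disjoints_subset subsetDr.
Qed.

Lemma weight_lt A c : (forall a, a \in A -> (sigma a < c)%N) ->
  (weight A < 2 ^ c)%N.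
Proof.
move=> A_lt; have -> : weight A = (\sum_(i in sigma @: A) 2 ^ i)%N.
  by rewrite big_imset //= => x y _ _; apply: sigma_inj.
have {A_lt} : forall i, i \in sigma @: A -> (i < c)%N.
  by move=> i /imsetP[a aA ->]; apply: A_lt.
elim: c (sigma @: A) => [|c IHc] S S_lt.
  by rewrite big1 // => i /S_lt.
have [/existsP[m /andP[mS /eqP mc]]|/existsPn nS] :=
    boolP [exists m, (m \in S) && (val m == c)].
  rewrite (big_setD1 m) //= mc expnS mul2n -addnn ltn_add2l; apply: IHc => i.
  rewrite !inE => /andP[nim /S_lt]; rewrite ltnS leq_eqVlt => /orP[|//].
  by rewrite -mc val_eqE (negPf nim).
apply: leq_trans (IHc S _) _; last by rewrite leq_exp2l.
move=> i iS; have := S_lt i iS; rewrite ltnS leq_eqVlt => /orP[ic|//].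
by have := nS i; rewrite iS ic.
Qed.

Lemma initial_countE A j : (j <= n./2)%N ->
  initial_count A j.*2 = (\sum_(k < n./2 | (k < j)%N) #|A :&: block k|)%N.
Proof.
move=> le_j; rewrite /initial_count -sum1_card.
have half_lt i : i \in [set a in A | (sigma a < j.*2)%N] ->
    ((sigma i)./2 < n./2)%N.
  by rewrite inE => /andP[_ lt_i]; lia.
case m_eq: (n./2) le_j half_lt => [|m] le_j half_lt.
  by rewrite big_ord0 big1 // => i /half_lt.
rewrite (partition_big (fun i => inord (sigma i)./2 : 'I_m.+1)
                       (fun k : 'I_m.+1 => (k < j)%N)) /=; last first.
  move=> i iA; rewrite inordK ?half_lt //.
  by move: iA; rewrite inE => /andP[_]; lia.
apply: eq_bigr => k lt_kj; rewrite -sum1_card; apply: eq_bigl => i.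
rewrite !inE -val_eqE /=; case iA: (i \in A) => //=.
have [lt_i|ge_i] := ltnP (sigma i) j.*2 => /=; last by lia.
by rewrite inordK // half_lt // inE iA.
Qed.

(** Sum over the blocks k < j: an empty, half-full or full block contains 0, 1
    or 2 elements of A, and the average is more than 1. *)
Lemma empty_blocks_lt_full_blocks A j : (j <= n./2)%N ->
    (j < initial_count A j.*2)%N ->
  (#|[set k : 'I_n./2 | (k < j)%N & [disjoint block k & A]]|
     < #|[set k : 'I_n./2 | (k < j)%N & block k \subset A]|)%N.
Proof.
move=> le_j; rewrite initial_countE // => lt_count.
have bE (P : pred nat) : #|[set k : 'I_n./2 | (k < j)%N & P k]|
    = (\sum_(k < n./2 | (k < j)%N) P k)%N.
  rewrite -sum1_card big_mkcond [RHS]big_mkcond; apply: eq_bigr => k _.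
  by rewrite !inE; case: (k < j)%N; case: (P k).
have jE : (\sum_(k < n./2 | (k < j)%N) 1 = j)%N.
  by rewrite -(big_ord_widen _ (fun _ => 1%N)) // sum_nat_const card_ord muln1.
rewrite (bE (fun k => [disjoint block k & A])).
rewrite (bE (fun k => block k \subset A)).
suff: (\sum_(k < n./2 | (k < j)%N) (#|A :&: block k| + [disjoint block k & A])
  <= \sum_(k < n./2 | (k < j)%N) (1 + (block k \subset A)))%N.
  by move: lt_count; rewrite !big_split /= jE; lia.
apply: leq_sum => k _; have k_card := card_block (ltn_ord k).
rewrite disjoint_sym -setI_eq0 -cards_eq0.
have := subset_leq_card (subsetIr A (block k)); rewrite k_card.
have [sk|/negP nsk] := boolP (block k \subset A).
  by rewrite (setIidPr sk) k_card.
move=> le2; suff : #|A :&: block k| != 2 by case: eqP; lia.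
apply/negP => /eqP card2; apply: nsk; apply/setIidPr/eqP.
by rewrite eqEcard subsetIr card2 k_card.
Qed.

End Blocks.

(** * Crowded monomials are leading monomials of multiples of one form *)

Section LeadingMonomial.
Variables (n : nat) (sigma : 'I_n -> 'I_n).
Hypothesis sigma_inj : injective sigma.
Implicit Types (A B : {set 'I_n}).

(** Split the form as a + p + q + r over the blocks that are full, half-full,
    empty, and beyond j. Modulo the form, a^d is (- (p + q + r))^d, where p
    kills x_A0 and q^d = 0, so that only multiples of r remain. *)
Lemma block_form_leading (K : numFieldType) A j : (j <= n./2)%N ->
    (j < initial_count sigma A j.*2)%N ->
  exists u : exterior K n, forall B, (weight sigma B <= weight sigma A)%N ->
    ext_coef (block_form sigma K * u) B = (B == A)%:R.
Proof.
move=> le_j lt_count.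
have := empty_blocks_lt_full_blocks sigma_inj le_j lt_count.
set Z := [set k | _ & [disjoint _ & _]]; set D := [set k | _ & _ \subset _].
move=> ltZD; pose y (k : 'I_n./2) := ext_monom K (block sigma k).
have y_central k u : GRing.comm (y k) u.
  by apply: comm_even_monom; rewrite card_block.
have y_sqr k : y k * y k = 0.
  by apply: ext_monom_sqr; rewrite -cards_eq0 card_block.
have sum_central (P : pred 'I_n./2) u : GRing.comm (\sum_(k | P k) y k) u.
  by apply/commr_sym/commr_sum => k _; apply/commr_sym.
pose Ds := enum D.
pose A0 := A :\: \bigcup_(k <- Ds) block sigma k; pose x0 := ext_monom K A0.
have A0P i :
    reflect (i \in A /\ forall k, k \in D -> i \notin block sigma k) (i \in A0).
  rewrite /A0 big_enum inE andbC; apply: (iffP andP) => -[iA iU]; split=> //.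
    by move=> k kD; apply: contra iU => ik; apply/bigcupP; exists k.
  by apply/bigcupP => -[k /iU /negP].
have [|k||b prodD] := @prod_monom_setD K n _ (block sigma \o val) Ds A.
- exact: enum_uniq.
- by rewrite mem_enum inE => /andP[].
- by move=> k l neq_kl; apply: block_disjoint.
pose p := \sum_(k : 'I_n./2 | (k < j)%N && (k \notin D) && (k \notin Z)) y k.
pose q := \sum_(k in Z) y k.
pose r := \sum_(k : 'I_n./2 | ~~ (k < j)%N) y k.
pose a := \sum_(k in D) y k; pose d := #|D|.
have formE : block_form sigma K = a + (p + (q + r)).
  rewrite /block_form (bigID (fun k : 'I__ => (k < j)%N)) /= -/r !addrA.
  congr (_ + _); rewrite (bigID (mem D)) /= -addrA; congr (_ + _).
    by apply: eq_bigl => k; rewrite !inE; case: (k < j)%N.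
  rewrite (bigID (mem Z)) /= addrC; congr (_ + _); apply: eq_bigl => k.
  rewrite !inE; case: (k < j)%N => //=; rewrite andbC.
  case: (boolP [disjoint _ & _]) => //= dk; apply: contraTN dk => sk.
  by rewrite -setI_eq0 (setIidPl sk) -cards_eq0 card_block.
have pow_a : a ^+ d * x0 = d`!%:R * ((-1) ^+ b *: ext_monom K A).
  rewrite -prodD mulrA /a /d cardE -big_enum /=; congr (_ * _).
  by have [-> _] := pow_sum_sqr0 (enum D) (fun k l => y_central k (y l)) y_sqr.
have pow_q : q ^+ d = 0.
  rewrite /d -(subnK ltZD) exprD /q (cardE Z) -big_enum /=.
  have [_ ->] := pow_sum_sqr0 (enum Z) (fun k l => y_central k (y l)) y_sqr.
  by rewrite mulr0.
have p_x0 : p * x0 = 0.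
  rewrite mulr_suml big1 // => k /andP[/andP[lt_kj kD] kZ].
  rewrite [LHS]ext_monomM ifF //; apply: contraNF kZ => dk.
  rewrite inE lt_kj /=.
  rewrite -setI_eq0; apply/eqP/setP => i; rewrite in_setI in_set0.
  apply/negP => /andP[ik iA]; have /negP[] := disjointFr dk ik; apply/A0P.
  split=> // l lD.
  have /disjointFr -> // : [disjoint block sigma k & block sigma l].
  by apply: block_disjoint; apply: contraNneq kD => /val_inj ->.
(* The elements of A missing from A0 lie below position 2j, and a block beyond
   j outweighs them all. *)
have r_x0 (w : exterior K n) B : (weight sigma B <= weight sigma A)%N ->
    ext_coef (w * (r * x0)) B = 0.
  move=> leBA; rewrite mulr_suml mulr_sumr ext_coef_big big1 // => k.
  rewrite -leqNgt => le_jk; rewrite [y k * x0]ext_monomM.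
  case: ifP => [dk|_]; last by rewrite mulr0 ext_coef0.
  rewrite -scalerAr ext_coefZ ext_coef_mul_monom ?mulr0 //.
  apply/negP => /(weight_sub sigma); apply/negP; rewrite -ltnNge.
  apply: (leq_ltn_trans leBA); rewrite weight_setU //.
  have sA0A : A0 \subset A by apply/subsetP => i /A0P[].
  rewrite -(setID A A0) (setIidPr sA0A) weight_setU; last first.
    by rewrite disjoint_sym disjoints_subset subsetDr.
  rewrite addnC ltn_add2r.
  apply: (@leq_trans (2 ^ j.*2)%N).
    apply: weight_lt => // i; rewrite inE => /andP[/A0P iA0 iA].
    have [/existsP[l /andP[lD il]]|/existsPn nl] :=
      boolP [exists l, (l \in D) && (i \in block sigma l)].
      by move: lD il; rewrite !inE => /andP[? _]; lia.
    by case: iA0; split=> // l lD; have := nl l; rewrite lD.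
  have /set0Pn[i ik] : block sigma k != set0 by rewrite -cards_eq0 card_block.
  rewrite /weight (bigD1 i) //= (leq_trans _ (leq_addr _ _)) // leq_exp2l //.
  by move: ik; rewrite inE; lia.
have [w1 Ew1] : exists w,
    a ^+ d = block_form sigma K * w + (- (p + (q + r))) ^+ d.
  exists (\sum_(i < d) a ^+ (d.-1 - i) * (- (p + (q + r))) ^+ i).
  have -> : block_form sigma K = a - (- (p + (q + r))) by rewrite opprK formE.
  by rewrite -subrXX_comm ?subrK //; apply: sum_central.
have [w2 Ew2] : exists w, (p + (q + r)) ^+ d = p * w + (q + r) ^+ d.
  exists (\sum_(i < d) (p + (q + r)) ^+ (d.-1 - i) * (q + r) ^+ i).
  rewrite -[X in X * _](addrK (q + r)) -subrXX_comm ?subrK //.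
  apply/commr_sym; do 2?[apply: commrD => //]; apply/commr_sym;
    exact: sum_central.
have [w3 Ew3] : exists w, (q + r) ^+ d = r * w.
  exists (\sum_(i < d) (q + r) ^+ (d.-1 - i) * q ^+ i).
  rewrite -[X in X * _](addrK q) [r + q]addrC -subrXX_comm ?pow_q ?subr0 //.
  by apply/commr_sym; apply: sum_central.
exists (((-1) ^+ b / d`!%:R) *: (w1 * x0)) => B leBA.
have dfact : d`!%:R != 0 :> K by rewrite pnatr_eq0 -lt0n fact_gt0.
rewrite -scalerAr ext_coefZ mulrA.
have -> : block_form sigma K * w1 * x0
    = a ^+ d * x0 - (- (p + (q + r))) ^+ d * x0 by rewrite Ew1 mulrDl addrK.
have coef_c : ext_coef ((- (p + (q + r))) ^+ d * x0) B = 0.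
  rewrite exprNn Ew2 Ew3 -mulrA mulrDl.
  have -> : p * w2 * x0 = w2 * (p * x0) by rewrite (sum_central _ w2) mulrA.
  have -> : r * w3 * x0 = w3 * (r * x0) by rewrite (sum_central _ w3) mulrA.
  by rewrite p_x0 mulr0 add0r [(-1) ^+ d * _]mulrA r_x0.
rewrite ext_coefD ext_coefN coef_c subr0 pow_a mulr_natl -scaler_nat.
rewrite !ext_coefZ ext_coef_monom.
by rewrite mulrA divfK // mulrA -expr2 sqrr_sign mul1r.
Qed.

End LeadingMonomial.

(** * Homogeneous elements and rescaling of the generators *)

Section Homogeneous.
Variables (K : fieldType) (n : nat).
Implicit Types (u v : exterior K n) (A B C : {set 'I_n}).

Lemma ext_gradedP u s :
  reflect (forall A, #|A| != s -> ext_coef u A = 0) (u \in ext_graded K n s).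
Proof.
apply: (iffP idP) => [u_s A nA|u_s]; last first.
  rewrite (ext_monom_sum u); apply: memv_suml => A _.
  have [As|/u_s->] := eqVneq #|A| s; last by rewrite scale0r mem0v.
  by apply/memvZ/memv_span/image_f; rewrite inE As.
rewrite (coord_span (u_s : u \in <<in_tuple _>>%VS)) ext_coef_sum.
rewrite big1 // => i _.
rewrite ext_coefZ; have /imageP[B] := mem_nth 0 (ltn_ord i).
rewrite inE => /eqP Bs ->; rewrite ext_coef_monom; case: eqP => [eAB|_].
  by rewrite eAB Bs eqxx in nA.
by rewrite mulr0.
Qed.

Lemma card_setD_add2 C B : C \subset B -> #|C| = 2 -> (#|B :\: C| + 2)%N = #|B|.
Proof.
by move=> sCB C2; have := cardsID C B; rewrite (setIidPr sCB) C2 addnC.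
Qed.

Lemma quadratic_mul_graded u v s : u \in ext_graded K n 2 ->
    (forall C, (#|C| + 2)%N != s -> ext_coef v C = 0) ->
  u * v \in ext_graded K n s.
Proof.
move=> /ext_gradedP u2 v_s; apply/ext_gradedP => B Bs.
rewrite [LHS]ext_coef_mul big1 // => C sCB.
have [C2|/u2->] := eqVneq #|C| 2; last by rewrite mulr0 mul0r.
by rewrite v_s ?mulr0 // card_setD_add2.
Qed.

(** The component of degree s - 2, written with an addition since it must
    vanish for s < 2. *)
Definition graded_part (s : nat) v : exterior K n :=
  ([ffun C : {set 'I_n} => if (#|C| + 2)%N == s then ext_coef v C else 0 : K^o]
   : {ffun {set 'I_n} -> K^o}).

Lemma ext_coef_quadratic_mul u v s B : u \in ext_graded K n 2 -> #|B| = s ->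
  ext_coef (u * graded_part s v) B = ext_coef (u * v) B.
Proof.
move=> /ext_gradedP u2 Bs; rewrite [LHS]ext_coef_mul [RHS]ext_coef_mul.
apply: eq_bigr => C sCB.
have [C2|/u2->] := eqVneq #|C| 2; last by rewrite mulr0 !mul0r.
by congr (_ * _); rewrite [LHS]ffunE card_setD_add2 // Bs eqxx.
Qed.

Variable sigma : 'I_n -> 'I_n.

(** The ring endomorphism that multiplies x_i by t to the power 2^(sigma i). *)
Definition torus (t : K) u : exterior K n :=
  ([ffun B : {set 'I_n} => t ^+ weight sigma B * ext_coef u B : K^o]
   : {ffun {set 'I_n} -> K^o}).

Lemma ext_coef_torus t u B :
  ext_coef (torus t u) B = t ^+ weight sigma B * ext_coef u B.
Proof. exact: ffunE. Qed.

Lemma torusM t u v : torus t (u * v) = torus t u * torus t v.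
Proof.
apply: ext_eqP => B; rewrite ext_coef_torus [X in _ * X = _]ext_coef_mul.
rewrite [RHS]ext_coef_mul mulr_sumr; apply: eq_bigr => C sCB.
have -> : weight sigma B = (weight sigma C + weight sigma (B :\: C))%N.
  rewrite -weight_setU; last by rewrite disjoint_sym disjoints_subset subsetDr.
  by congr weight; rewrite -{1}(setID B C) (setIidPr sCB).
by rewrite !ext_coef_torus exprD; ring.
Qed.

End Homogeneous.

Lemma poly_nonroot (K : numFieldType) (p : {poly K}) :
  p != 0 -> exists x, p.[x] != 0.
Proof.
move=> p0; pose rs := [seq i%:R : K | i <- iota 0 (size p)].
have [/(max_poly_roots p0)|/allPn[x _ nx]] := boolP (all (root p) rs);
  last by exists x.
rewrite map_inj_uniq; last by apply: mulrIn; rewrite oner_eq0.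
by rewrite iota_uniq size_map size_iota ltnn => /(_ isT).
Qed.

(** * Two special forms with many independent multiples *)

Section Degeneration.
Variable n : nat.
Implicit Types (A B C : {set 'I_n}).

Definition direction (b : bool) : 'I_n -> 'I_n := if b then id else @rev_ord n.

Lemma direction_inj b : injective (direction b).
Proof. by case: b => //; apply: rev_ord_inj. Qed.

(** Only even lengths are tested, so that the initial segments are unions of
    blocks; [not_crowded_le] recovers the odd lengths. *)
Definition crowded (b : bool) A : bool :=
  [exists j : 'I_(n./2).+1, (j < initial_count (direction b) A j.*2)%N].

Definition crowded_sets (s : nat) : {set {set 'I_n}} :=
  [set A : {set 'I_n} | (#|A| == s) && (crowded true A || crowded false A)].

Lemma block_form_graded (K : fieldType) b :
  block_form (direction b) K \in ext_graded K n 2.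
Proof.
apply: memv_suml => k _; apply: memv_span; apply: image_f; rewrite inE.
by rewrite card_block //; apply: direction_inj.
Qed.

(** The multiples are rescaled so that x_A keeps coefficient 1 in the one
    attached to A; every other coefficient on a crowded monomial is then zero or
    divisible by t. The matrix M of polynomials in t has the identity as its
    value at 0, so that its determinant is nonzero at some rational t != 0. *)
Lemma exists_independent_multiples s : exists (f : bool -> exterior rat n)
    (u : {set 'I_n} -> exterior rat n),
  [/\ forall b, f b \in ext_graded rat n 2,
      forall A C, (#|C| + 2)%N != s -> ext_coef (u A) C = 0
    & \det (\matrix_(i < #|crowded_sets s|, j < #|crowded_sets s|)
        ext_coef (f (crowded true (enum_val i)) * u (enum_val i))
          (enum_val j)) != 0].
Proof.
pose sg A := direction (crowded true A).
pose leads A (v : exterior rat n) := A \in crowded_sets s ->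
  forall B, (weight (sg A) B <= weight (sg A) A)%N ->
  ext_coef (block_form (sg A) rat * v) B = (B == A)%:R.
have [u uP] : exists u, forall A, leads A (u A).
  apply: (@fin_all_exists _ _ leads) => A; rewrite /leads.
  have [A_in|_] := boolP (A \in crowded_sets s); last by exists 0.
  have /existsP[j lt_j] : crowded (crowded true A) A.
    by move: A_in; rewrite inE; case: (boolP (crowded true A)) => //= _ /andP[].
  have [|v vP] :=
      block_form_leading (@direction_inj (crowded true A)) rat _ lt_j.
    by rewrite -ltnS.
  by exists v.
pose h A := block_form (sg A) rat * u A.
(* The truncated subtraction gives exponent 0 to the monomials that are not
   heavier than x_A, whose coefficients are those of x_A. *)
pose M := \matrix_(i < #|crowded_sets s|, j < #|crowded_sets s|)
  ((ext_coef (h (enum_val i)) (enum_val j))%:P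
   * 'X^(weight (sg (enum_val i)) (enum_val j)
         - weight (sg (enum_val i)) (enum_val i))).
have detM t : (\det M).[t] = \det (map_mx (horner_eval t) M).
  by rewrite det_map_mx.
have M0 : \det M != 0.
  apply/eqP => det0; have := detM 0; rewrite det0 horner0.
  have -> : map_mx (horner_eval 0) M = 1%:M.
    apply/matrixP => i j; rewrite !mxE /horner_eval hornerM hornerC hornerXn.
    set A := enum_val i; set B := enum_val j.
    have AN : A \in crowded_sets s by apply: enum_valP.
    have [le_BA|lt_AB] := leqP (weight (sg A) B) (weight (sg A) A).
      rewrite uP // (eqP le_BA) expr0 mulr1 (inj_eq enum_val_inj).
      by rewrite eq_sym.
    rewrite expr0n subn_eq0 leqNgt lt_AB mulr0.
    by case: eqP lt_AB => [eij|//]; rewrite /A /B eij ltnn.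
  by rewrite det1 => /esym/eqP; rewrite oner_eq0.
(* The factor 'X excludes t = 0, where the rescaling is not invertible. *)
have [t] : exists t, ('X * \det M).[t] != 0.
  by apply: poly_nonroot; rewrite mulf_neq0 // polyX_eq0.
rewrite hornerM hornerX mulf_eq0 negb_or => /andP[t0 dett].
exists (fun b => torus (direction b) t (block_form (direction b) rat)).
exists (fun A => graded_part s (t ^- weight (sg A) A *: torus (sg A) t (u A))).
have f2 b : torus (direction b) t (block_form (direction b) rat)
    \in ext_graded rat n 2.
  apply/ext_gradedP => A A2; rewrite ext_coef_torus.
  by move/ext_gradedP: (block_form_graded rat b) => ->; rewrite ?mulr0.
split=> // [A C nC|]; first by rewrite [LHS]ffunE (negPf nC).
move: dett; rewrite detM; congr (\det _ != 0).
apply/matrixP => i j; rewrite !mxE /horner_eval hornerM hornerC hornerXn.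
have := enum_valP i; have := enum_valP j.
set A := enum_val i; set B := enum_val j; move=> BN AN.
have Bs : #|B| = s by move: BN; rewrite inE => /andP[/eqP].
rewrite ext_coef_quadratic_mul // -scalerAr -torusM ext_coefZ ext_coef_torus.
rewrite -/(sg A) -/(h A) mulrA [RHS]mulrC.
have [le_BA|lt_AB] := leqP (weight (sg A) B) (weight (sg A) A).
  rewrite /h uP //; case: eqP => [->|_]; last by rewrite !mul0r.
  by rewrite subnn mulVf ?expf_neq0.
by rewrite -[in RHS](subnK (ltnW lt_AB)) addnC exprD mulKf ?expf_neq0.
Qed.

End Degeneration.

(** * From special to generic forms *)

Section Genericity.
Variable n : nat.
Implicit Types (A B C : {set 'I_n}).

Definition quad_index : finType := (bool * {A : {set 'I_n} | #|A| == 2})%type.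

Definition coef_var b C : {mpoly rat[#|quad_index|]} :=
  if insub C is Some C2 then 'X_(enum_rank (b, C2) : 'I_#|quad_index|) else 0.

(** The coefficient on x_B of f v (b true) or g v (b false) as a polynomial in
    the coefficients of f and g, for a fixed rational multiplier v. *)
Definition product_coef b (v : exterior rat n) B : {mpoly rat[#|quad_index|]} :=
  \sum_(C : {set 'I_n} | C \subset B)
    (ext_sign rat C (B :\: C) * ext_coef v (B :\: C)) *: coef_var b C.

Definition ext_ratr (K : numFieldType) (v : exterior rat n) : exterior K n :=
  ([ffun B => ratr (ext_coef v B) : K^o] : {ffun {set 'I_n} -> K^o}).

Lemma ext_coef_ratr (K : numFieldType) v B :
  ext_coef (ext_ratr K v) B = ratr (ext_coef v B).
Proof. exact: ffunE. Qed.

Definition quad_point (K : fieldType) (f g : exterior K n)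
    (k : 'I_#|quad_index|) : K :=
  quad_coefs f g (enum_val k : quad_index).

Lemma meval_product_coef (K : numFieldType) (f g : exterior K n) b v B :
    f \in ext_graded K n 2 -> g \in ext_graded K n 2 ->
  (map_mpoly (ratr : rat -> K) (product_coef b v B)).@[quad_point f g]
    = ext_coef ((if b then f else g) * ext_ratr K v) B.
Proof.
move=> f2 g2; rewrite [RHS]ext_coef_mul /product_coef.
rewrite [map_mpoly _ _]raddf_sum [LHS]raddf_sum /=.
apply: eq_bigr => C sCB; rewrite map_mpolyZ mevalZ rmorphM /= ext_coef_ratr.
rewrite /ext_sign rmorph_sign mulrAC; congr (_ * _ * _).
rewrite /coef_var.
case: (insubP {A : {set 'I_n} | #|A| == 2} C) => [C2 _ C2E|nC2].
  rewrite map_mpolyX mevalXU /quad_point /quad_coefs enum_rankK /=.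
  by rewrite C2E; case: b.
have fg2 : (if b then f else g) \in ext_graded K n 2 by case: b.
by rewrite !rmorph0; move/ext_gradedP: fg2 => ->.
Qed.

Lemma ratr_rat (x : rat) : ratr x = x.
Proof. by rewrite -(fmorph_eq_rat (idfun : {rmorphism rat -> rat})). Qed.

Lemma ext_ratr_rat v : ext_ratr rat v = v.
Proof. by apply: ext_eqP => A; rewrite ext_coef_ratr ratr_rat. Qed.

(** The determinant of the coefficients is one polynomial with rational
    coefficients, evaluated once at the special forms and once at the generic
    ones; by algebraic independence the latter value vanishes only if the
    polynomial is zero. *)
Lemma generic_independent_multiples (K : numFieldType) (f g : exterior K n) s :
    generic_quadratic_pair f g ->
  exists u : {set 'I_n} -> exterior K n,
  (forall A C, (#|C| + 2)%N != s -> ext_coef (u A) C = 0) /\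
  \det (\matrix_(i < #|crowded_sets n s|, j < #|crowded_sets n s|)
     ext_coef ((if crowded true (enum_val i) then f else g) * u (enum_val i))
       (enum_val j)) != 0.
Proof.
case=> f2 g2 fg_indep.
have [f1 [u [f1_2 u_s det_u]]] := exists_independent_multiples n s.
exists (fun A => ext_ratr K (u A)); split=> [A C nC|].
  by rewrite ext_coef_ratr u_s // rmorph0.
pose M := \matrix_(i < #|crowded_sets n s|, j < #|crowded_sets n s|)
  product_coef (crowded true (enum_val i)) (u (enum_val i)) (enum_val j).
have detE (L : numFieldType) (f' g' : exterior L n) :
    f' \in ext_graded L n 2 -> g' \in ext_graded L n 2 ->
  (map_mpoly (ratr : rat -> L) (\det M)).@[quad_point f' g'] =
  \det (\matrix_(i < #|crowded_sets n s|, j < #|crowded_sets n s|)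
     ext_coef ((if crowded true (enum_val i) then f' else g')
               * ext_ratr L (u (enum_val i))) (enum_val j)).
  move=> f'2 g'2; rewrite -det_map_mx /= -det_map_mx /=; congr (\det _).
  by apply/matrixP => i j; rewrite !mxE meval_product_coef.
apply: contra det_u => /eqP; rewrite -detE // => /fg_indep detM0.
have := detE _ _ _ (f1_2 true) (f1_2 false).
rewrite detM0 !rmorph0 => /esym det0; rewrite -[X in _ == X]det0.
apply/eqP; congr (\det _).
by apply/matrixP => i j; rewrite !mxE ext_ratr_rat; case: crowded.
Qed.

Lemma card_crowded_le_dim (K : numFieldType) (f g : exterior K n) s :
    generic_quadratic_pair f g ->
  (#|crowded_sets n s| <= \dim (ext_graded K n s :&: ideal_gen2 f g))%N.
Proof.
move=> fg_gen; have [u [u_s det_u]] := generic_independent_multiples s fg_gen.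
have [f2 g2 _] := fg_gen.
pose h A := (if crowded true A then f else g) * u A.
pose X := [tuple h (enum_val i) | i < #|crowded_sets n s|].
have freeX : free X.
  apply/freeP => k sum0.
  pose M := \matrix_(i < #|crowded_sets n s|, j < #|crowded_sets n s|)
    ext_coef (h (enum_val i)) (enum_val j).
  have M_unit : M \in unitmx by rewrite unitmxE unitfE.
  have : \row_i k i *m M = 0.
    apply/rowP => j; rewrite !mxE.
    rewrite -[RHS](ext_coef0 K (enum_val j)) -sum0 ext_coef_sum.
    apply: eq_bigr => i _; rewrite !mxE ext_coefZ.
    by rewrite (nth_map i) ?size_enum_ord // nth_ord_enum.
  move/(canRL (mulmxK M_unit)); rewrite mul0mx => k0 i.
  by move/rowP/(_ i): k0; rewrite !mxE.
have dimX : \dim <<X>> = #|crowded_sets n s|.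
  by rewrite (eqP (freeX : _ == _)) size_tuple.
rewrite -dimX; apply: dimvS; apply/span_subvP => x /tnthP[i ->{x}].
rewrite tnth_mktuple memv_cap; apply/andP; split.
  by apply: quadratic_mul_graded; [case: crowded | apply: u_s].
set A := enum_val i.
have -> : h A = 1 * (if crowded true A then f else g) * u A.
  by rewrite mul1r.
apply: memv_mul; last exact: memvf.
apply: memv_mul; first exact: memvf.
by case: ifP => _; apply: memv_span; rewrite !inE eqxx ?orbT.
Qed.

End Genericity.

(** * Sets that are not crowded are lattice paths *)

Arguments direction : simpl never.

Section Counting.
Variable n : nat.
Implicit Types (A B : {set 'I_n}).

Notation prefix_count := (initial_count (@direction n true)).

Lemma prefix_countS A (i : 'I_n) :
  prefix_count A i.+1 = ((i \in A) + prefix_count A i)%N.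
Proof.
rewrite /initial_count /direction (cardsD1 i) !inE ltnSn andbT.
congr (_ + #|pred_of_set _|)%N.
apply/setP => a; rewrite !inE ltnS [(a < i)%N]ltn_neqAle val_eqE.
by case: (a == i); rewrite //= andbF.
Qed.

Lemma prefix_count_inj A B :
  (forall i, (i <= n)%N -> prefix_count A i = prefix_count B i) -> A = B.
Proof.
move=> eqAB; apply/setP => i; have := eqAB i.+1 (ltn_ord i).
rewrite !prefix_countS eqAB 1?ltnW // => /addIn.
by case: (i \in A); case: (i \in B).
Qed.

Lemma prefix_count0 A : prefix_count A 0 = 0%N.
Proof. by apply: eq_card0 => a; rewrite !inE andbF. Qed.

Lemma prefix_countn A : prefix_count A n = #|A|.
Proof. by apply: eq_card => a; rewrite !inE ltn_ord andbT. Qed.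

Lemma prefix_count_rev A (i : nat) : (i <= n)%N ->
  (initial_count (direction false) A (n - i) + prefix_count A i)%N = #|A|.
Proof.
move=> le_in; rewrite -(cardsID [set a : 'I_n | (a < i)%N] A) addnC.
congr (_ + _)%N.
  by apply: eq_card => a; rewrite !inE.
apply: eq_card => a; rewrite !inE /= andbC; congr (_ && _).
by have := ltn_ord a; lia.
Qed.

Lemma initial_countS_le (sigma : 'I_n -> 'I_n) A c : injective sigma ->
  (initial_count sigma A c.+1 <= (initial_count sigma A c).+1)%N.
Proof.
move=> sigma_inj; have sub : [set a in A | (sigma a < c.+1)%N] \subset
    [set a in A | (sigma a < c)%N] :|: [set a | val (sigma a) == c].
  apply/subsetP => a; rewrite !inE ltnS leq_eqVlt => /andP[-> /orP[->|->]] //.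
  by rewrite orbT.
apply: (leq_trans (subset_leq_card sub)).
apply: (leq_trans (leq_card_setU _ _)).
rewrite -addn1 leq_add2l.
apply/card_le1_eqP => a b; rewrite !inE => /eqP ac /eqP bc.
by apply/sigma_inj/val_inj; rewrite ac bc.
Qed.

(** An initial segment of odd length has at most one more element of A than
    the even one before it. *)
Lemma not_crowded_le b A c : ~~ crowded b A -> (c <= n)%N ->
  ((initial_count (direction b) A c).*2 <= c.+1)%N.
Proof.
move=> /existsPn nb le_cn; have lt_h : (c./2 < n./2.+1)%N by lia.
have := nb (Ordinal lt_h); rewrite -leqNgt /= => le_half.
have [c_eq|c_eq] : c = c./2.*2 \/ c = c./2.*2.+1 by lia.
  by rewrite c_eq; lia.
have := initial_countS_le A c./2.*2 (@direction_inj n b); rewrite -c_eq; lia.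
Qed.

(** The abscissa after k steps of the path of A. With steps numbered from 0,
    steps 0 and n + 1 go up, and step j + 1 goes down if j \in A and up
    otherwise. *)
Definition lattice_height A (k : nat) : nat :=
  if k is j.+1 then (if (j <= n)%N then j.+1 - (prefix_count A j).*2
                     else n.+2 - #|A|.*2)%N
  else 0%N.

Arguments lattice_height : simpl never.

(** Up to step n + 1 the truncated subtraction in [lattice_height] is exact:
    this is the left wall of the strip and comes from the prefixes of A. The
    right wall comes from the suffixes. *)
Lemma lattice_heightE A k :
    (k <= n.+2)%N -> ~~ crowded true A -> ~~ crowded false A ->
  [/\ (lattice_height A k <= n + 2 - 2 * #|A|)%N,
      (0 < k <= n.+1)%N ->
        (lattice_height A k + (prefix_count A k.-1).*2 = k)%N
    & k = n.+2 -> lattice_height A k = (n + 2 - 2 * #|A|)%N].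
Proof.
case: k => [|j] le_j nA1 nA2 //; rewrite /lattice_height /=.
have := not_crowded_le nA1; have := not_crowded_le nA2.
have [le_jn|lt_nj] := leqP j n => H2 H1; last by split; lia.
have := H1 _ le_jn; have := H2 (n - j)%N (leq_subr _ _).
have := prefix_count_rev A le_jn.
move=> sum_eq leP leS; split; [by rewrite -sum_eq; lia | lia | lia].
Qed.

Lemma lattice_height_step A k :
    (k <= n.+1)%N -> ~~ crowded true A -> ~~ crowded false A ->
  (lattice_height A k.+1 == (lattice_height A k).+1)
  || (lattice_height A k == (lattice_height A k.+1).+1).
Proof.
move=> le_k nA1 nA2.
have [_ + +] := lattice_heightE (le_k : (k.+1 <= n.+2)%N) nA1 nA2.
have [_ + _] := lattice_heightE (leqW le_k) nA1 nA2.
case: k le_k => [_ _|j le_j]; first by rewrite /lattice_height /= prefix_count0.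
move=> /(_ le_j) /= ej ejS ejn.
have [lt_jn|le_nj] := ltnP j n.
  have := prefix_countS A (Ordinal lt_jn); have := ejS lt_jn; rewrite /=.
  by case: (_ \in A); lia.
have jn : j = n by lia.
have := prefix_countn A; move: ej (ejn (congr1 (fun i => i.+2) jn)); rewrite jn.
by move=> ej1 ej2 cE; rewrite -cE in ej2; lia.
Qed.

Definition set_path (s : nat) A :
    (n + 2).-tuple (rectangle (n + 2 - 2 * s) (n + 2)) :=
  [tuple (inord (lattice_height A k.+1), inord k.+1) | k < n + 2].

Lemma nth_set_path s A k : (k <= n + 2)%N ->
  nth (ord0, ord0) ((ord0, ord0) :: set_path s A) k
    = (inord (lattice_height A k), inord k).
Proof.
case: k => [_|k lt_k] /=.
  by congr (_, _); apply/val_inj; rewrite /= inordK.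
have := tnth_nth (ord0, ord0) (set_path s A) (Ordinal lt_k).
by rewrite tnth_mktuple /= => <-.
Qed.

Definition balanced_sets (s : nat) : {set {set 'I_n}} :=
  [set A : {set 'I_n} | (#|A| == s) && ~~ (crowded true A || crowded false A)].

(** A set is recovered from its path, since the heights determine how many
    elements each initial segment contains. *)
Lemma card_balanced_le_num_paths s : (#|balanced_sets s| <= num_paths n s)%N.
Proof.
have bal A : A \in balanced_sets s ->
    [/\ #|A| = s, ~~ crowded true A & ~~ crowded false A].
  by rewrite inE negb_or => /and3P[/eqP].
rewrite /num_paths; case: (leqP (2 * s) (n + 2)) => [le_s|lt_s]; last first.
  (* After n + 1 steps the height would be n + 1 - 2s, which is negative. *)
  rewrite leqn0 cards_eq0 -subset0; apply/subsetP => A /bal[As nA1 nA2].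
  have [_ + _] := lattice_heightE (leqnSn n.+1) nA1 nA2.
  by rewrite prefix_countn As; lia.
rewrite -(card_in_imset (f := set_path s)); last first.
  move=> A B /bal[As nA1 nA2] /bal[Bs nB1 nB2] eqAB.
  apply: prefix_count_inj => i le_i.
  have [leA + _] := lattice_heightE (leqW le_i : (i.+1 <= n.+2)%N) nA1 nA2.
  have [leB + _] := lattice_heightE (leqW le_i : (i.+1 <= n.+2)%N) nB1 nB2.
  have lt_i : (i.+1 <= n + 2)%N by lia.
  have := nth_set_path s A lt_i; rewrite eqAB nth_set_path // => -[].
  move=> /(congr1 val) /=; rewrite !inordK ?ltnS -?{1}Bs //;
    last by rewrite Bs -As.
  by move=> ->; lia.
apply/subset_leq_card/subsetP => t /imsetP[A /bal[As nA1 nA2] ->{t}].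
have lt_h k : (k <= n + 2)%N -> (lattice_height A k < (n + 2 - 2 * s).+1)%N.
  move=> le_k; have [|+ _ _] := @lattice_heightE A k _ nA1 nA2.
    by lia.
  by rewrite As; lia.
rewrite inE; apply/andP; split; last first.
  rewrite (last_nth (ord0, ord0)) size_tuple.
  rewrite nth_set_path // xpair_eqE -!val_eqE /= !inordK ?lt_h // eqxx andbT.
  by have [|_ _ ->] := @lattice_heightE A (n + 2) _ nA1 nA2; rewrite ?As; lia.
apply/(pathP (ord0, ord0)) => i; rewrite size_tuple => lt_i.
rewrite nth_set_path 1?ltnW //; set p := set_path s A.
rewrite -[nth _ p i]/(nth (ord0, ord0) ((ord0, ord0) :: tval p) i.+1).
rewrite nth_set_path // /path_move /= !inordK ?lt_h ?ltnS ?(ltnW lt_i) //.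
rewrite eqxx /=.
by apply: lattice_height_step => //; lia.
Qed.

End Counting.

(** * The upper bound *)

(* C is R[i] for an arbitrary model R of the real numbers. *)
Theorem theorem5 (R : realType) (n : nat) (n_gt0 : (0 < n)%N)
    (f g : exterior R[i] n) (fg_generic : generic_quadratic_pair f g)
    (s : nat) :
  (\dim (quot_graded (ideal_gen2 f g) s) <= num_paths n s)%N.
Proof.
have le_crowded := card_crowded_le_dim s fg_generic.
apply: leq_trans (card_balanced_le_num_paths n s).
have := dim_quot_graded (ideal_gen2 f g) s; rewrite dim_ext_graded.
have -> : 'C(n, s) = (#|crowded_sets n s| + #|balanced_sets n s|)%N.
  rewrite -[n in LHS]card_ord -card_draws.
  rewrite -(cardsID [set A | crowded true A || crowded false A]).
  congr (_ + _)%N.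
    by apply: eq_card => A; rewrite !inE.
  by apply: eq_card => A; rewrite !inE andbC.
by move=> dimE; rewrite -(leq_add2l #|crowded_sets n s|) -dimE leq_add2r.
Qed.
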